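(* Let $\mathcal A=(A_i;\varphi_{i,j};c_{i,j})$ and $\mathcal A'=(A_i';\varphi_{i,j}';c_{i,j}')$ be two indecomposable affine meshes over the same index set $I$. Then the sums of $\mathcal A$ and $\mathcal A'$ are isomorphic quandles if and only if the meshes $\mathcal A$ and $\mathcal A'$ are homologous.
   Context: A quandle is a non-empty set $Q$ with a binary operation such that for all $x,y,z$: $xx=x$; $x(yz)=(xy)(xz)$; and $xu=y$ has a unique solution $u\in Q$. An affine mesh over a non-empty set $I$ is a triple $((A_i)_{i\in I},(\varphi_{i,j})_{i,j\in I},(c_{i,j})_{i,j\in I})$, written $(A_i;\varphi_{i,j};c_{i,j})$, where $A_i$ are abelian groups, $\varphi_{i,j}:A_i\to A_j$ are homomorphisms and $c_{i,j}\in A_j$ are constants, such that for all $i,j,j',k\in I$: (M1) $1-\varphi_{i,i}$ is an automorphism of $A_i$ (where $1$ is the identity map); (M2) $c_{i,i}=0$; (M3) $\varphi_{j,k}\varphi_{i,j}=\varphi_{j',k}\varphi_{i,j'}$; (M4) $\varphi_{j,k}(c_{i,j})=\varphi_{k,k}(c_{i,k}-c_{j,k})$. The mesh is indecomposable if for every $j\in I$ the group $A_j$ is generated by $\bigcup_{i\in I}(c_{i,j}+\mathrm{Im}(\varphi_{i,j}))$. The sum of an affine mesh $(A_i;\varphi_{i,j};c_{i,j})$ over $I$ is the binary algebra on the disjoint union of the sets $A_i$ with operation $a*b=c_{i,j}+\varphi_{i,j}(a)+(1-\varphi_{j,j})(b)$ for $a\in A_i$, $b\in A_j$; it is a (medial)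 quandle. Two affine meshes $\mathcal A=(A_i;\varphi_{i,j};c_{i,j})$ and $\mathcal A'=(A_i';\varphi_{i,j}';c_{i,j}')$ over the same index set $I$ are homologous if there are a permutation $\pi$ of $I$, group isomorphisms $\psi_i:A_i\to A'_{\pi i}$ ($i\in I$) and constants $d_i\in A'_{\pi i}$ ($i\in I$) such that for all $i,j\in I$: (H1) $\psi_j\varphi_{i,j}=\varphi'_{\pi i,\pi j}\psi_i$; (H2) $\psi_j(c_{i,j})=c'_{\pi i,\pi j}+\varphi'_{\pi i,\pi j}(d_i)-\varphi'_{\pi j,\pi j}(d_j)$. *)

(* Defs.v *)
From mathcomp Require Import all_boot all_algebra.
From mathcomp Require Import classical_sets.

Set Implicit Arguments.
Unset Strict Implicit.
Unset Printing Implicit Defensive.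

Import GRing.Theory.
Local Open Scope ring_scope.
Local Open Scope classical_set_scope.

Record quandle := Quandle {
  quandle_sort :> Type;
  qop : quandle_sort -> quandle_sort -> quandle_sort;
  quandle_nonempty : inhabited quandle_sort;
  qop_idem : forall x, qop x x = x;
  qop_distl : forall x y z, qop x (qop y z) = qop (qop x y) (qop x z);
  qop_divl : forall x y, exists! u, qop x u = y
}.

Definition quandle_isomorphic (Q Q' : quandle) : Prop :=
  exists2 f : Q -> Q', bijective f & {morph f : x y / qop x y}.

Definition subgroup (G : zmodType) (H : set G) : Prop :=
  H 0 /\ forall x y, H x -> H y -> H (x - y).

Definition generated_by (G : zmodType) (X : set G) : Prop :=
  smallest (@subgroup G) X = setT.

(* [zmodType] bundles a choice operator with the abelian group structure;
   classically every abelian group carries one, so this is no restriction. *)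
Record affine_mesh (I : Type) := AffineMesh {
  mesh_group :> I -> zmodType;
  mesh_hom : forall i j, {additive mesh_group i -> mesh_group j};
  mesh_cst : forall i j : I, mesh_group j;
  mesh_nonempty : inhabited I;
  (* additivity of [idfun \- mesh_hom i i] is automatic, so that bijectivity
     makes it an automorphism *)
  mesh_M1 : forall i, bijective (idfun \- mesh_hom i i);
  mesh_M2 : forall i, mesh_cst i i = 0;
  mesh_M3 : forall i j j' k,
    mesh_hom j k \o mesh_hom i j =1 mesh_hom j' k \o mesh_hom i j';
  mesh_M4 : forall i j k,
    mesh_hom j k (mesh_cst i j) = mesh_hom k k (mesh_cst i k - mesh_cst j k)
}.

Definition indecomposable (I : Type) (A : affine_mesh I) : Prop :=
  forall j, generated_by
    (\bigcup_(i in [set: I]) [set mesh_cst A i j + y | y in range (mesh_hom A i j)]).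

Section Sum.
Variables (I : Type) (A : affine_mesh I).

Definition sum_op (x y : {i : I & A i}) : {i : I & A i} :=
  let: existT i a := x in
  let: existT j b := y in
  existT _ j (mesh_cst A i j + mesh_hom A i j a + (idfun \- mesh_hom A j j) b).

Lemma sum_nonempty : inhabited {i : I & A i}.
Proof. by case: (mesh_nonempty A) => i; exists; exists i; exact: 0. Qed.

Lemma sum_op_idem x : sum_op x x = x.
Proof.
by case: x => i a /=; rewrite mesh_M2 add0r addrC subrK.
Qed.

Lemma sum_op_distl x y z :
  sum_op x (sum_op y z) = sum_op (sum_op x y) (sum_op x z).
Proof.
case: x y z => [i a] [j b] [k c] /=; congr existT.
have M3a := @mesh_M3 I A i j k k a; have M3b := @mesh_M3 I A j j k k b.
rewrite /= in M3a M3b.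
move: (c - _) => w.
rewrite !raddfD !raddfN /= M3a M3b (mesh_M4 A i j k) raddfB !addrA.
rewrite [RHS](ACl (7*8*1*5*9*3*6*12*(2*10)*(4*11))) /=.
by rewrite !subrr !addr0.
Qed.

Lemma sum_op_divl x y : exists! u, sum_op x u = y.
Proof.
case: x => i a; have [g fK gK] := mesh_M1 A (tag y).
exists (existT _ (tag y)
  (g (tagged y - (mesh_cst A i (tag y) + mesh_hom A i (tag y) a)))); split.
  by rewrite /sum_op gK addrC subrK; case: (y).
case=> k c E; case: _ / E g fK gK => g fK _ /=.
by rewrite [X in g X]addrC addKr (fK c).
Qed.

Definition mesh_sum : quandle :=
  Quandle sum_nonempty sum_op_idem sum_op_distl sum_op_divl.
End Sum.

Definition homologous (I : Type) (A A' : affine_mesh I) : Prop :=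
  exists (pi : I -> I) (psi : forall i, {additive A i -> A' (pi i)})
         (d : forall i, A' (pi i)),
    [/\ bijective pi,
        forall i, bijective (psi i),
        forall i j,
          psi j \o mesh_hom A i j =1 mesh_hom A' (pi i) (pi j) \o psi i
      & forall i j,
          psi j (mesh_cst A i j) = mesh_cst A' (pi i) (pi j)
            + mesh_hom A' (pi i) (pi j) (d i) - mesh_hom A' (pi j) (pi j) (d j)].

(* Main.v *)
Require Import Defs.
From HB Require Import structures.
From mathcomp Require Import all_boot all_algebra.
From mathcomp Require Import boolp classical_sets.

Set Implicit Arguments.
Unset Strict Implicit.
Unset Printing Implicit Defensive.

Import GRing.Theory.
Local Open Scope ring_scope.
Local Open Scope classical_set_scope.

(** In the sum of an indecomposable mesh the components [A j] are exactly the
    classes of the equivalence generated by [y ~ x * y].  Left multiplications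
    never leave a component, and the moves [y ~ x * y] relate elements of [A j]
    that differ by a generator [mesh_cst A i j + mesh_hom A i j a], hence all of
    them ([orbit_invariant_const]).  A quandle isomorphism therefore permutes
    the components ([same_component_morph]): it is given by a bijection [pi] of
    the indices and maps [g i : A i -> A' (pi i)] ([morph_componentwise]).

    Put [d i = g i 0] and [psi i a = g i a - d i].  The morphism identity becomes
    [psi j (c + phi a + (1 - phi) b) = k i j + phi' (psi i a) + (1 - phi') (psi j b)]
    with [k i j = c' + phi' (d i) - phi' (d j)] ([recenter_morph]).  The right
    side splits as a function of [a] plus a function of [b], and [1 - phi] is
    onto, so [psi j] is additive when one argument is a generator; those
    arguments form a subgroup, so [psi j] is additive ([recenter_additive]).
    The compatibility of [psi] with the homomorphisms and the constants of the
    meshes is then read off by setting arguments to [0].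
    Conversely, from a homology the map [a |-> psi i a + d i] is an isomorphism,
    by the same identity read backwards. *)

(** * Preliminaries *)

(** Injectivity of the second component over an arbitrary index type, where
    proof irrelevance replaces decidable equality. *)
Lemma existT_inj2 (I : Type) (T : I -> Type) (i : I) (a b : T i) :
  existT T i a = existT T i b -> a = b.
Proof.
have tagged_eq y : existT T i a = y ->
    exists p : i = projT1 y, eq_rect i T a _ p = projT2 y.
  by move=> <-; exists erefl.
by move=> /tagged_eq [p]; rewrite (Prop_irrelevance p erefl).
Qed.

Lemma inj_surj_bij (T U : Type) (f : T -> U) :
  injective f -> (forall y, exists x, f x = y) -> bijective f.
Proof.
move=> f_inj f_surj; pose g y := projT1 (cid (f_surj y)).
have gK : cancel g f by move=> y; rewrite /g; case: cid.
by exists g => // x; apply: f_inj; rewrite gK.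
Qed.

Lemma additive_of (U V : zmodType) (f : U -> V) :
  {morph f : x y / x + y} -> {g : {additive U -> V} | g =1 f}.
Proof.
move=> fD; have f0 : f 0 = 0 by apply: (addrI (f 0)); rewrite -fD !addr0.
have fB : zmod_morphism f.
  move=> x y; apply: (addIr (f y)).
  by rewrite -fD !subrK.
pose F := GRing.isZmodMorphism.Build U V f fB.
by exists (HB.pack_for {additive U -> V} f F).
Qed.

Lemma generated_ind (G : zmodType) (X H : set G) :
  generated_by X -> subgroup H -> X `<=` H -> forall x, H x.
Proof.
move=> gX sH XH x.
have : (smallest (@subgroup G) X) x by rewrite gX.
by apply; split.
Qed.

(** * Components of the sum as orbits *)

Lemma mesh_unit_surj (I : Type) (A : affine_mesh I) (j : I) (b : A j) :
  exists b0, b0 - mesh_hom A j j b0 = b.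
Proof. by have [u _ uK] := mesh_M1 A j; exists (u b); exact: uK. Qed.

(** Elements of [A j] differing by a generator are linked by two moves: writing
    [b = (1 - phi) b0], both [b] and [c + phi a + b] are of the form [x * b0]. *)
Lemma orbit_invariant_const (I : Type) (A : affine_mesh I) (T : Type)
    (t : mesh_sum A -> T) :
  indecomposable A -> (forall x y, t (qop x y) = t y) ->
  forall j (b b' : A j), t (existT _ j b) = t (existT _ j b').
Proof.
move=> indA tE j b b'.
pose H : set (A j) :=
  [set h | forall b : A j, t (existT _ j (h + b)) = t (existT _ j b)].
suff /(_ (b - b') b') : forall h, H h by rewrite subrK.
apply: (generated_ind (indA j)).
  split=> [b0|h1 h2 H1 H2 b0]; first by rewrite add0r.
  by rewrite -addrA H1 -[LHS]H2 addrA subrr add0r.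
move=> _ [i _ [_ [a _ <-] <-]] b1; have [b0 <-] := mesh_unit_surj b1.
have := tE (existT _ j (0 : A j)) (existT _ j b0).
have := tE (existT _ i a) (existT _ j b0).
by rewrite /qop /= /sum_op mesh_M2 raddf0 !add0r => -> ->.
Qed.

Lemma same_component_morph (I J : Type) (A : affine_mesh I) (B : affine_mesh J)
    (f : mesh_sum A -> mesh_sum B) :
  indecomposable A -> {morph f : x y / qop x y} ->
  forall x y, projT1 x = projT1 y -> projT1 (f x) = projT1 (f y).
Proof.
move=> indA fM [i a] [j b] /= ij; case: _ / ij b => b.
apply: (orbit_invariant_const (t := fun x => projT1 (f x))) => // x y.
by rewrite fM; case: (f x) (f y) => [? ?] [? ?].
Qed.

Lemma morph_componentwise (I J : Type) (A : affine_mesh I) (B : affine_mesh J)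
    (f : mesh_sum A -> mesh_sum B) :
  indecomposable A -> {morph f : x y / qop x y} ->
  exists (pi : I -> J) (g : forall i, A i -> B (pi i)),
    forall i a, f (existT _ i a) = existT _ (pi i) (g i a).
Proof.
move=> indA fM; pose pi i := projT1 (f (existT _ i (0 : A i))).
have ex i (a : A i) : exists b : B (pi i), f (existT _ i a) = existT _ (pi i) b.
  have : projT1 (f (existT _ i a)) = pi i by exact: same_component_morph.
  by case: (f _) => k b /= kE; case: _ / kE; exists b.
by exists pi, (fun i a => projT1 (cid (ex i a))) => i a; case: cid.
Qed.

(** * Morphisms given componentwise *)

(** The morphism identity for the sums, written inside the groups: it avoids
    equalities of dependent pairs. *)
Definition mesh_morph (I J : Type) (A : affine_mesh I) (B : affine_mesh J)
    (pi : I -> J) (g : forall i, A i -> B (pi i)) : Prop :=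
  forall i j (a : A i) (b : A j),
    g j (mesh_cst A i j + mesh_hom A i j a + (b - mesh_hom A j j b)) =
    mesh_cst B (pi i) (pi j) + mesh_hom B (pi i) (pi j) (g i a)
      + (g j b - mesh_hom B (pi j) (pi j) (g j b)).

Lemma mesh_morphP (I J : Type) (A : affine_mesh I) (B : affine_mesh J)
    (pi : I -> J) (g : forall i, A i -> B (pi i))
    (f : mesh_sum A -> mesh_sum B) :
  (forall i a, f (existT _ i a) = existT _ (pi i) (g i a)) ->
  {morph f : x y / qop x y} <-> mesh_morph g.
Proof.
move=> fE; split=> [fM i j a b|gM [i a] [j b]]; last first.
  by rewrite [LHS]fE !fE; congr existT; exact: gM.
have := fM (existT _ i a) (existT _ j b).
by rewrite [f (qop _ _)]fE !fE; exact: existT_inj2.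
Qed.

Definition shifted_cst (I J : Type) (B : affine_mesh J) (pi : I -> J)
    (d : forall i, B (pi i)) (i j : I) : B (pi j) :=
  mesh_cst B (pi i) (pi j) + mesh_hom B (pi i) (pi j) (d i)
    - mesh_hom B (pi j) (pi j) (d j).

(** Translating every component by [d] only changes the constants of the target
    mesh; the new constants are those to which a homology sends the constants of
    the source. *)
Lemma recenter_morph (I J : Type) (A : affine_mesh I) (B : affine_mesh J)
    (pi : I -> J) (psi : forall i, A i -> B (pi i)) (d : forall i, B (pi i)) :
  mesh_morph (fun i a => psi i a + d i) <->
  forall i j (a : A i) (b : A j),
    psi j (mesh_cst A i j + mesh_hom A i j a + (b - mesh_hom A j j b)) =
    shifted_cst d i j + mesh_hom B (pi i) (pi j) (psi i a)
      + (psi j b - mesh_hom B (pi j) (pi j) (psi j b)).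
Proof.
have E i j (a : A i) (b : A j) :
    mesh_cst B (pi i) (pi j) + mesh_hom B (pi i) (pi j) (psi i a + d i)
      + ((psi j b + d j) - mesh_hom B (pi j) (pi j) (psi j b + d j)) =
    shifted_cst d i j + mesh_hom B (pi i) (pi j) (psi i a)
      + (psi j b - mesh_hom B (pi j) (pi j) (psi j b)) + d j.
  rewrite /shifted_cst !raddfD /= !addrA.
  by rewrite [LHS](ACl (1*3*7*2*4*6*5)).
split=> H i j a b; last by rewrite H E.
by apply: (addIr (d j)); rewrite -E; exact: H.
Qed.

Lemma shifted_cstii (I J : Type) (B : affine_mesh J) (pi : I -> J)
    (d : forall i, B (pi i)) (i : I) : shifted_cst d i i = 0.
Proof. by rewrite /shifted_cst mesh_M2 add0r subrr. Qed.

(** The [u] such that [psi j] is additive at [(u, v)] for all [v] form a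
    subgroup.  It contains the generators because, with [v = (1 - phi) b], the
    right side of the recentred identity is a term in [a] plus a term in [b]. *)
Lemma recenter_additive (I J : Type) (A : affine_mesh I) (B : affine_mesh J)
    (pi : I -> J) (psi : forall i, A i -> B (pi i)) (d : forall i, B (pi i)) :
  indecomposable A -> (forall i, psi i 0 = 0) ->
  mesh_morph (fun i a => psi i a + d i) ->
  forall j, {morph psi j : u v / u + v}.
Proof.
move=> indA psi0 /recenter_morph psiE j u.
move: u; apply: (generated_ind (H := [set u | forall v, _]) (indA j)).
  split=> [v|u1 u2 /= H1 H2 v]; first by rewrite psi0 !add0r.
  have psiBl w : psi j (- u2 + w) = - psi j u2 + psi j w.
    by apply: (addrI (psi j u2)); rewrite -H2 !addNKr.
  have := psiBl 0; rewrite psi0 !addr0 => psiN.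
  by rewrite -addrA !H1 psiBl psiN addrA.
move=> _ [i _ [_ [a _ <-] <-]] v /=.
have [w <-] := mesh_unit_surj v.
have psi_gen : psi j (mesh_cst A i j + mesh_hom A i j a) =
    shifted_cst d i j + mesh_hom B (pi i) (pi j) (psi i a).
  by have := psiE i j a 0; rewrite psi0 !raddf0 !addr0.
have psi_unit : psi j (w - mesh_hom A j j w) =
    psi j w - mesh_hom B (pi j) (pi j) (psi j w).
  have := psiE j j 0 w.
  by rewrite mesh_M2 shifted_cstii psi0 !raddf0 !add0r.
by rewrite psiE psi_gen psi_unit.
Qed.

(** The two equations of a homology amount to the morphism identity: at [b = 0]
    it gives the equation on constants for [a = 0], and then by additivity the
    equation on homomorphisms. *)
Lemma additive_mesh_morphP (I J : Type) (A : affine_mesh I) (B : affine_mesh J)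
    (pi : I -> J) (psi : forall i, {additive A i -> B (pi i)})
    (d : forall i, B (pi i)) :
  mesh_morph (fun i a => psi i a + d i) <->
  (forall i j,
      psi j \o mesh_hom A i j =1 mesh_hom B (pi i) (pi j) \o psi i) /\
  (forall i j, psi j (mesh_cst A i j) = shifted_cst d i j).
Proof.
rewrite recenter_morph; split=> [psiE|[H1 H2] i j a b]; last first.
  have := H1 i j a; have := H1 j j b; rewrite /= => Hb Ha.
  by rewrite !raddfD raddfN /= Ha Hb H2.
have H2 i j : psi j (mesh_cst A i j) = shifted_cst d i j.
  by have := psiE i j 0 0; rewrite !raddf0 !addr0.
split=> // i j a /=; have := psiE i j a 0.
by rewrite !raddf0 !addr0 raddfD /= H2 => /addrI.
Qed.

(** * Bijectivity *)

Lemma glue_bij (I J : Type) (T : I -> Type) (U : J -> Type) (pi : I -> J)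
    (g : forall i, T i -> U (pi i)) :
  bijective pi -> (forall i, bijective (g i)) ->
  bijective (fun x => existT U (pi (projT1 x)) (g _ (projT2 x))).
Proof.
move=> pi_bij g_bij; apply: inj_surj_bij.
  move=> [i a] [j b] /= E.
  have ij : i = j by apply: (bij_inj pi_bij); case: E.
  case: _ / ij b E => b E; congr existT.
  exact: (bij_inj (g_bij i) (existT_inj2 E)).
case: pi_bij => pj _ pjK [j b]; rewrite -(pjK j) in b *.
by case: (g_bij (pj j)) => h _ hK; exists (existT _ (pj j) (h b)); rewrite /= hK.
Qed.

(** Injectivity of [pi] and surjectivity of the [g i] come from the inverse of
    the isomorphism, which also preserves components; hence [B] has to be
    indecomposable as well. *)
Lemma component_bij (I J : Type) (A : affine_mesh I) (B : affine_mesh J)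
    (f : mesh_sum A -> mesh_sum B) (pi : I -> J)
    (g : forall i, A i -> B (pi i)) :
  indecomposable B -> bijective f -> {morph f : x y / qop x y} ->
  (forall i a, f (existT _ i a) = existT _ (pi i) (g i a)) ->
  bijective pi /\ forall i, bijective (g i).
Proof.
move=> indB [f' fK f'K] fM fE.
have f'M : {morph f' : x y / qop x y}.
  by move=> x y; apply: (can_inj fK); rewrite fM !f'K.
have pi_inj : injective pi.
  move=> i j ij.
  have := same_component_morph indB f'M
    (x := f (existT _ i (0 : A i))) (y := f (existT _ j (0 : A j))).
  by rewrite !fK !fE; apply.
split=> [|i]; apply: inj_surj_bij => //.
- move=> j; have := f'K (existT _ j (0 : B j)); case: (f' _) => i a.
  by rewrite fE => /(congr1 (@projT1 _ _)) /= <-; exists i.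
- move=> a b E; have := fE i a; rewrite E -fE.
  by move=> /(can_inj fK); exact: existT_inj2.
- move=> b; have := f'K (existT _ (pi i) b); case: (f' _) => k a.
  rewrite fE => E.
  have ki : k = i by apply: pi_inj; case: E.
  by case: _ / ki b E => b E; exists a; exact: existT_inj2 E.
Qed.

(** * Isomorphism and homology *)

Theorem theorem4p2 (I : Type) (A A' : affine_mesh I) :
  indecomposable A -> indecomposable A' ->
  (quandle_isomorphic (mesh_sum A) (mesh_sum A') <-> homologous A A').
Proof.
move=> indA indA'; split=> [[f f_bij fM]|[pi [psi [d [pi_bij psi_bij H1 H2]]]]].
  have [pi [g fE]] := morph_componentwise indA fM.
  have [pi_bij g_bij] := component_bij indA' f_bij fM fE.
  pose d i := g i 0.
  have gM : mesh_morph (fun i a => (g i a - d i) + d i).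
    move=> i j a b /=; rewrite !subrK.
    exact: (proj1 (mesh_morphP fE) fM).
  have g0 i : g i 0 - d i = 0 by exact: subrr.
  pose psi i := projT1 (additive_of (recenter_additive indA g0 gM (j := i))).
  have psiE i : psi i =1 fun a => g i a - d i by rewrite /psi; case: additive_of.
  have psiM : mesh_morph (fun i a => psi i a + d i).
    by move=> i j a b; rewrite !psiE; exact: gM.
  have [H1 H2] := proj1 (additive_mesh_morphP psi d) psiM.
  exists pi, psi, d; split=> // i.
  apply: (eq_bij (f := fun a => g i a - d i)); last by move=> a; rewrite psiE.
  have [h hK Kh] := g_bij i.
  by exists (fun b => h (b + d i)) => x; rewrite ?subrK ?Kh ?addrK.
have psiM : mesh_morph (fun i a => psi i a + d i).
  exact: (proj2 (additive_mesh_morphP psi d)).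
exists (fun x => existT _ (pi (projT1 x)) (psi _ (projT2 x) + d _)).
  refine (glue_bij (T := fun i => A i) (U := fun i => A' i)
            (g := fun i a => psi i a + d i) pi_bij _) => i.
  have [h hK Kh] := psi_bij i.
  by exists (fun b => h (b - d i)) => x; rewrite ?addrK ?Kh ?subrK.
by apply/(mesh_morphP (g := fun i a => psi i a + d i)).
Qed.
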